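(* Let $k$ be a field, $G$ a finite group, and $X,Y$ faithful $G$-sets with $\#X=\#Y=n$. Choose bijections $X\to\{1,\ldots,n\}$ and $Y\to\{1,\ldots,n\}$, let $\varphi_X,\varphi_Y:G\to S_n$ be the resulting action homomorphisms, and let $X'=S_n/\varphi_X(G)$ and $Y'=S_n/\varphi_Y(G)$ be the corresponding transitive $S_n$-sets. If $X$ and $Y$ are linearly equivalent over $k$ as $G$-sets, then $X'$ and $Y'$ are linearly equivalent over $k$ as $S_n$-sets.
   Context: For a finite group $\Gamma$ and a finite $\Gamma$-set $Z$, $k[Z]$ denotes the permutation module of maps $Z\to k$, a module over the group algebra $k\Gamma$. Two finite $\Gamma$-sets $Z,W$ are linearly equivalent over $k$ if $k[Z]\cong k[W]$ as $k\Gamma$-modules. The isomorphism classes of $X'$ and $Y'$ do not depend on the chosen bijections. *)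

(* Defs.v *)
From HB Require Import structures.
From mathcomp Require Import all_boot all_order all_algebra all_fingroup.

Set Implicit Arguments.
Unset Strict Implicit.
Unset Printing Implicit Defensive.

Import GRing.Theory.
Local Open Scope ring_scope.

(* MathComp actions are right actions. A left action is read as the right
   action z.g := g^-1 z; under this dictionary the left coset x H becomes the
   right coset H x^-1, and the left translate f(g^-1 z) of a map f by g becomes
   f(z.g). *)

(* Group algebra of gT over k: maps gT -> k under convolution. *)
Definition group_algebra (k : fieldType) (gT : finGroupType) : Type :=
  {ffun gT -> k}.

Section GroupAlgebra.
Variables (k : fieldType) (gT : finGroupType).
Local Notation kG := (group_algebra k gT).

HB.instance Definition _ := GRing.Zmodule.copy kG {ffun gT -> k}.

Implicit Types a b c : kG.

Definition galg_one : kG := [ffun g : gT => (g == 1%g)%:R].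

Definition galg_mul a b : kG :=
  [ffun g : gT => \sum_(h : gT) a h * b (h^-1 * g)%g].

Fact galg_mulA : associative galg_mul.
Proof.
move=> a b c; apply/ffunP=> g; rewrite !ffunE.
under eq_bigr => h _ do rewrite ffunE mulr_sumr.
under [RHS]eq_bigr => h _ do rewrite ffunE mulr_suml.
rewrite [RHS]exchange_big /=; apply: eq_bigr => h _.
rewrite [RHS](reindex_inj (mulgI h)) /=; apply: eq_bigr => x _.
by rewrite mulKg invMg mulrA mulgA.
Qed.

Fact galg_mul1r : left_id galg_one galg_mul.
Proof.
move=> a; apply/ffunP=> g; rewrite ffunE (bigD1 1%g) //= big1 => [|h /negPf h1].
  by rewrite ffunE eqxx mul1r invg1 mul1g addr0.
by rewrite ffunE h1 mul0r.
Qed.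

Fact galg_mulr1 : right_id galg_one galg_mul.
Proof.
move=> a; apply/ffunP=> g; rewrite ffunE (bigD1 g) //= big1 => [|h hg].
  by rewrite ffunE mulVg eqxx mulr1 addr0.
by rewrite ffunE -eq_mulVg1 (negPf hg) mulr0.
Qed.

Fact galg_mulDl : left_distributive galg_mul +%R.
Proof.
move=> a b c; apply/ffunP=> g; rewrite !ffunE -big_split /=.
by apply: eq_bigr => h _; rewrite ffunE mulrDl.
Qed.

Fact galg_mulDr : right_distributive galg_mul +%R.
Proof.
move=> a b c; apply/ffunP=> g; rewrite !ffunE -big_split /=.
by apply: eq_bigr => h _; rewrite ffunE mulrDr.
Qed.

Fact galg_one_neq0 : galg_one != 0.
Proof.
by apply/eqP=> /ffunP/(_ 1%g)/eqP; rewrite !ffunE eqxx oner_eq0.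
Qed.

HB.instance Definition _ := GRing.Zmodule_isNzRing.Build kG
  galg_mulA galg_mul1r galg_mulr1 galg_mulDl galg_mulDr galg_one_neq0.

End GroupAlgebra.

(* The type mentions the action so that its module structure can be inferred. *)
Definition perm_module (k : fieldType) (gT : finGroupType) (Z : finType)
    (to : {action gT &-> Z}) : Type := {ffun Z -> k}.

Section PermutationModule.
Variables (k : fieldType) (gT : finGroupType) (Z : finType).
Variable to : {action gT &-> Z}.
Local Notation kG := (group_algebra k gT).
Local Notation kZ := (perm_module k to).

HB.instance Definition _ := GRing.Zmodule.copy kZ {ffun Z -> k}.

Definition perm_module_scale (a : kG) (f : kZ) : kZ :=
  [ffun z : Z => \sum_(g : gT) a g * f (to z g)].

Fact perm_module_scaleA a b f :
  perm_module_scale a (perm_module_scale b f) = perm_module_scale (a * b) f.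
Proof.
apply/ffunP=> z; rewrite !ffunE.
under eq_bigr => h _ do rewrite ffunE mulr_sumr.
under [RHS]eq_bigr => h _ do rewrite ffunE mulr_suml.
rewrite [RHS]exchange_big /=; apply: eq_bigr => h _.
rewrite [RHS](reindex_inj (mulgI h)) /=; apply: eq_bigr => g _.
by rewrite mulKg actM mulrA.
Qed.

Fact perm_module_scale1 : left_id 1 perm_module_scale.
Proof.
move=> f; apply/ffunP=> z; rewrite ffunE (bigD1 1%g) //= big1 => [|g /negPf g1].
  by rewrite ffunE eqxx mul1r act1 addr0.
by rewrite ffunE g1 mul0r.
Qed.

Fact perm_module_scaleDr : right_distributive perm_module_scale +%R.
Proof.
move=> a f1 f2; apply/ffunP=> z; rewrite !ffunE -big_split /=.
by apply: eq_bigr => g _; rewrite ffunE mulrDr.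
Qed.

Fact perm_module_scaleDl f :
  {morph perm_module_scale^~ f : a b / a + b}.
Proof.
move=> a b; apply/ffunP=> z; rewrite !ffunE -big_split /=.
by apply: eq_bigr => g _; rewrite ffunE mulrDl.
Qed.

HB.instance Definition _ := GRing.Zmodule_isLmodule.Build kG kZ
  perm_module_scaleA perm_module_scale1 perm_module_scaleDr perm_module_scaleDl.

End PermutationModule.

(* {linear _ -> _} is linearity over the ring group_algebra k gT. *)
Definition linearly_equivalent (k : fieldType) (gT : finGroupType)
    (Z W : finType) (toZ : {action gT &-> Z}) (toW : {action gT &-> W}) : Prop :=
  exists phi : {linear perm_module k toZ -> perm_module k toW}, bijective phi.

Section TransportedAction.
Variables (gT : finGroupType) (X Y : finType) (to : {action gT &-> X}).
Variables (b : X -> Y) (b' : Y -> X) (bK : cancel b b') (b'K : cancel b' b).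

Definition transport_fun (y : Y) (g : gT) : Y := b (to (b' y) g).

Fact transport_fun1 : transport_fun^~ 1%g =1 id.
Proof. by move=> y; rewrite /transport_fun act1 b'K. Qed.

Fact transport_funM y : act_morph transport_fun y.
Proof. by move=> g h; rewrite /transport_fun bK actM. Qed.

Definition transport_action : {action gT &-> Y} :=
  TotalAction transport_fun1 transport_funM.

End TransportedAction.

Definition action_hom (gT : finGroupType) (X : finType) (n : nat)
    (to : {action gT &-> X}) (b : X -> 'I_n) (b' : 'I_n -> X)
    (bK : cancel b b') (b'K : cancel b' b) :
    {morphism [set: gT] >-> {perm 'I_n}} :=
  [morphism of actperm (transport_action to bK b'K)].

Section CosetAction.
Variables (gT : finGroupType) (H : {group gT}).

Definition coset_space : finType := {C : {set gT} | C \in rcosets H [set: gT]}.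

Fact coset_space_closed (C : coset_space) (g : gT) :
  (val C :* g)%g \in rcosets H [set: gT].
Proof.
have /rcosetsP[x _ ->] := valP C.
by rewrite -rcosetM mem_rcosets mulSGid ?subsetT ?inE.
Qed.

Definition coset_fun (C : coset_space) (g : gT) : coset_space :=
  Sub (val C :* g)%g (coset_space_closed C g).

Fact coset_fun1 : coset_fun^~ 1%g =1 id.
Proof. by move=> C; apply: val_inj; rewrite /= mulg1. Qed.

Fact coset_funM C : act_morph coset_fun C.
Proof. by move=> g h; apply: val_inj; rewrite /= rcosetM. Qed.

Definition coset_action : {action gT &-> coset_space} :=
  TotalAction coset_fun1 coset_funM.

End CosetAction.

(* Main.v *)
Require Import Defs.
From HB Require Import structures.
From mathcomp Require Import all_boot all_order all_algebra all_fingroup.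

(* Let V = k[X]. As a module over G x S_m, the tensor power of V with exponent m
   is k[X^m], so k[X^m] and k[Y^m] are isomorphic. Splitting maps from {1..m} to X
   according to their fibres writes k[X^m] as k[Inj(m, X)] plus a part that is
   determined by the modules k[Inj(l, X)] with l < m. By induction on m and
   cancellation of direct summands (as in the Krull-Schmidt theorem),
   k[Inj(m, X)] and k[Inj(m, Y)] are isomorphic over G x S_m. For m = n the
   bijections identify Inj(n, X) with S_n, and G-invariants give k[X'] = k[Y'].

   Cancellation is proved for idempotents in the commutant of a family of
   matrices: if c has no proper sub-idempotent, the corner ring at c has stable
   range one, which suffices; otherwise c is split and one inducts on its rank. *)

Set Implicit Arguments.
Unset Strict Implicit.
Unset Printing Implicit Defensive.

Import GRing.Theory.
Local Open Scope ring_scope.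

(** * Cancellation of idempotents in a commutant of matrices *)

Lemma strongly_pi_regular (k : fieldType) n (s : 'M[k]_n) :
  exists m y, s ^+ m.+1 * y = s ^+ m /\
    forall z : 'M[k]_n, GRing.comm z s -> GRing.comm z y.
Proof.
case: n s => [|n] s.
  by exists 0%N, 0; split=> [|z _]; rewrite /GRing.comm; apply/matrixP=> -[].
have : exists2 p : {poly k}, p != 0 & horner_mx s p = 0.
  by exists (char_poly s); [rewrite monic_neq0 ?char_poly_monic | exact: Cayley_Hamilton].
(* Factor the annihilating polynomial as ['X^m * q] with [q.[0] != 0]; splitting off the constant
   term of [q] solves for [s ^+ m]. The resulting [y] is a polynomial in [s], hence commutes with
   all that commutes with [s]. *)
case=> p p0 sp0; have [m [q q0 def_p]] := multiplicity_XsubC p 0.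
have := horner_mx_X s => sX.
move: q0; rewrite p0 /= => q0.
have [q1 def_q] : exists q1, q = q.[0]%:P + 'X * q1.
  have /factor_theorem[q1 dq] : root (q - q.[0]%:P) 0.
    by rewrite /root !hornerE subrr.
  by exists q1; rewrite -[q in LHS](subrK q.[0]%:P) dq subr0 mulrC addrC.
exists m, (horner_mx s (- q.[0]^-1 *: q1)); split; last first.
  by move=> z zs; apply: comm_mx_horner.
have: s ^+ m * horner_mx s q = 0.
  rewrite -sp0 def_p subr0 rmorphM rmorphXn /= sX.
  by rewrite -{1 4}sX -!(rmorphXn, rmorphM) /= mulrC.
rewrite {1}def_q rmorphD rmorphM /= sX horner_mx_C mulrDr => /eqP.
rewrite addr_eq0 => /eqP E1.
rewrite scaleNr rmorphN /= horner_mxZ -scalerN -scalerAr mulrN exprSr -mulrA.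
rewrite -[X in _ *: X]E1 -scalemx1 -scalerAr mulr1 scalerA mulVf ?scale1r //.
Qed.

Section Cancellation.
Variables (k : fieldType) (n : nat) (I : Type) (M : I -> 'M[k]_n).
Local Notation R := 'M[k]_n.
Implicit Types (a b c d e s u v x y : R).

Definition commutant x := forall i, GRing.comm (M i) x.
Local Notation E := commutant.

Lemma commutantM x y : E x -> E y -> E (x * y).
Proof. by move=> Ex Ey i; apply: commrM. Qed.
Lemma commutantD x y : E x -> E y -> E (x + y).
Proof. by move=> Ex Ey i; apply: commrD. Qed.
Lemma commutantB x y : E x -> E y -> E (x - y).
Proof. by move=> Ex Ey i; apply: commrB. Qed.
Lemma commutantX x m : E x -> E (x ^+ m).
Proof. by move=> Ex i; apply: commrX. Qed.
Lemma commutant0 : E 0.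
Proof. by move=> i; apply: commr0. Qed.

(** For idempotents, [u] and [v] are mutually inverse maps between the summands cut out by [e] and
    [f]. *)
Definition idem_iso e f :=
  exists u v, [/\ E u, E v & [/\ u * v = e, v * u = f, e * u = u & f * v = v]].

Definition idem e := e * e = e.
Definition orth e f := e * f = 0 /\ f * e = 0.

Ltac in_commutant := repeat first [assumption | apply: commutantX
  | apply: commutantM | apply: commutantB | apply: commutantD | apply: commutant0].

(** [d] is strongly pi-regular, so in [y * d ^+ m.+1 = d ^+ m] the powers cancel against a right
    inverse, which leaves [y * d = c]. Compressing [y] by [c] moves it into the corner. *)
Lemma corner_inverse c d r : E c -> E d -> idem c ->
    c * d = d -> d * c = d -> d * r = c ->
  exists w, [/\ E w, d * w = c, w * d = c, c * w = w & w * c = w].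
Proof.
move=> Ec Ed cc cd dc dr; have [m [y [dy yP]]] := strongly_pi_regular d.
have Ey : E y by move=> i; apply: yP.
have dyC : d * y = y * d by apply: yP.
have [r' dr'] : exists r', d ^+ m.+1 * r' = c.
  elim: m {dy} => [|m [r' dr']]; first by exists r.
  by exists (r' * r); rewrite exprS mulrA -(mulrA d) dr' dc dr.
have ydm : y * d ^+ m.+1 = d ^+ m.
  by rewrite -dy; apply/commrX.
have yd : y * d = c.
  by rewrite -{1}dc -{1}dr' 2!mulrA -(mulrA y) -exprS exprSr mulrA ydm -exprSr.
exists (c * y * c); split; first by in_commutant.
- by rewrite !mulrA dc dyC yd cc.
- by rewrite -!mulrA cd yd cc.
- by rewrite !mulrA cc.
by rewrite -!mulrA cc.
Qed.

(* The corner ring at [c] has stable range one as soon as it contains no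
   idempotent besides 0 and [c]: then [s] is nilpotent or invertible there. *)
Lemma corner_stable_range c d d' s : E c -> E d -> E d' -> E s -> idem c ->
    c * d = d -> d * c = d -> c * s = s -> s * c = s -> d * d' + s = c ->
  (exists x w, [/\ E x, E w & [/\ x * c = x, (d + s * x) * w = c,
     w * (d + s * x) = c, c * w = w & w * c = w]]) \/
  (exists e, [/\ E e, idem e, c * e = e, e * c = e & e != 0 /\ e != c]).
Proof.
move=> Ec Ed Ed' Es cc cd dc cs sc dds.
have [m [y [sy yP]]] := strongly_pi_regular s.
have Ey : E y by move=> i; apply: yP.
have syC : s * y = y * s by apply: yP.
(* Fitting idempotent of [s]: it is 0 exactly when [s] is nilpotent, and [c] exactly when [s] is
   invertible in the corner. *)
pose e := s ^+ m.+1 * y ^+ m.+1.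
have Ee : E e by rewrite /e; in_commutant.
have eC : e = y ^+ m.+1 * s ^+ m.+1 by apply: commrX; apply/commr_sym/commrX.
have se j : s ^+ m.+1 * (s * y) ^+ j = s ^+ m.+1.
  elim: j => [|j IHj]; first by rewrite mulr1.
  by rewrite (exprSr (s * y)) mulrA IHj mulrA -exprSr exprS -mulrA sy -exprS.
have {}se : s ^+ m.+1 * e = s ^+ m.+1 by rewrite /e -exprMn_comm // se.
have ee : idem e by rewrite /idem {1}eC -mulrA se -eC.
have ce : c * e = e by rewrite /e exprS !mulrA cs.
have ec : e * c = e by rewrite eC (exprSr s) -!mulrA sc.
have [e0|e0] := eqVneq e 0; last have [e1|e1] := eqVneq e c.
(* [s] is nilpotent, so [d * d' = c - s] is inverted by a geometric series and [x = 0] works. *)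
- left; exists 0.
  have s0 : s ^+ m.+1 = 0 by rewrite -se e0 mulr0.
  have dr : d * (d' * ((\sum_(i < m.+1) s ^+ i) * c)) = c.
    rewrite mulrA (_ : d * d' = - (c * (s - 1))); last first.
      by rewrite mulrBr mulr1 opprB cs -dds addrK.
    by rewrite mulNr mulrA -(mulrA c) -subrX1 s0 sub0r mulrN1 mulNr opprK.
  have [w [Ew dw wd cw wc]] := corner_inverse Ec Ed cc cd dc dr.
  by exists w; split=> //; [exact: commutant0 | rewrite mul0r mulr0 addr0].
(* [s] is invertible in the corner; [x] solves [s * x = c - d], so [d + s * x] is [c] itself. *)
- left; exists (s ^+ m * y ^+ m.+1 * (c - d)), c.
  have dx : d + s * (s ^+ m * y ^+ m.+1 * (c - d)) = c.
    by rewrite !mulrA -exprS -/e e1 mulrBr cc cd addrC subrK.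
  split; [by in_commutant | by [] |].
  by rewrite dx cc -mulrA mulrBl cc dc.
by right; exists e.
Qed.

(* If the corner [c -> d] of the matrix [u : a + c -> b + d] is invertible, then
   so is its Schur complement [a -> b]. *)
Lemma schur_complement a b c d u v w :
    E a -> E b -> E c -> E d -> E u -> E v -> E w ->
    idem a -> idem b -> idem c -> idem d ->
    a * c = 0 -> c * a = 0 -> b * d = 0 -> d * b = 0 ->
    u * v = a + c -> v * u = b + d -> (a + c) * u = u -> (b + d) * v = v ->
    c * u * d * w = c -> w * c * u * d = d ->
  idem_iso a b.
Proof.
move=> Ea Eb Ec Ed Eu Ev Ew aa bb cc dd ac ca bd db uv vu eu fv uw wu.
have ubd : u * b + u * d = u by rewrite -mulrDr -vu mulrA uv.
have vac : v * a + v * c = v by rewrite -mulrDr -uv mulrA vu.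
(* [key1] and [key2] express that the off-diagonal blocks [c * (u * v) * a] and [b * (v * u) * d]
   vanish. *)
have key1 : c * u * b * v * a = - (c * u * d * v * a).
  apply/eqP; rewrite -addr_eq0 -2!mulrDl -!(mulrA c) -mulrDr ubd.
  by rewrite -(mulrA c) uv mulrDr cc ca add0r ca.
have key2 : b * v * a * u * d = - (b * v * c * u * d).
  apply/eqP; rewrite -addr_eq0 -2!mulrDl -!(mulrA b) -mulrDr vac.
  by rewrite -(mulrA b) vu mulrDr bb bd addr0 bd.
(* As in block inversion, the Schur complement of [c * u * d] is inverted by the block [b * v * a]
   of [v]. *)
exists (a * u * b - a * u * d * w * c * u * b), (b * v * a).
split; [by in_commutant|by in_commutant|split].
- rewrite mulrBl !mulrA -2!(mulrA _ b b) bb.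
  have -> : a * u * d * w * c * u * b * v * a = a * u * d * w * (c * u * b * v * a).
    by rewrite !mulrA.
  rewrite key1 mulrN opprK.
  have -> : a * u * d * w * (c * u * d * v * a) = a * u * (d * (w * c * u * d)) * v * a.
    by rewrite !mulrA.
  rewrite wu dd -2!mulrDl -!(mulrA a) -mulrDr ubd -(mulrA a) uv.
  by rewrite mulrDr aa ac addr0 aa.
- rewrite mulrBr !mulrA -!(mulrA _ a a) aa.
  have -> : b * v * a * u * d * w * c * u * b = b * v * a * u * d * (w * c * u * b).
    by rewrite !mulrA.
  rewrite key2 mulNr opprK.
  have -> : b * v * c * u * d * (w * c * u * b) = b * v * (c * u * d * w) * c * u * b.
    by rewrite !mulrA.
  rewrite uw -!(mulrA _ c c) cc -2!mulrDl -!(mulrA b) -mulrDr vac -(mulrA b) vu.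
  by rewrite mulrDr bb bd addr0 bb.
- by rewrite mulrBr !mulrA aa.
- by rewrite !mulrA bb.
Qed.

Lemma mxrank_idem_lt c e : idem c -> idem e -> c * e = e -> e * c = e -> e != c ->
  (\rank e < \rank c)%N.
Proof.
move=> cc ee ce ec; rewrite ltn_neqAle => nec; apply/andP; split; last first.
  by rewrite -ec; apply: mxrankM_maxr.
apply: contra nec => /eqP rec.
have : (e <= c)%MS by rewrite -ec; apply: submxMl.
move/mxrank_leqif_sup/geq_leqif; rewrite rec leqnn => /esym/submxP[x dc].
by rewrite -ce dc -[x *m e]/(x * e) -mulrA ee.
Qed.

(* If the corner at [c] has a proper idempotent, [c] and [d] are split along it;
   otherwise stable range one provides a transvection [1 + t] after which the
   block [c -> d] of the isomorphism is invertible. *)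
Theorem idem_cancel a b c d : E a -> E b -> E c -> E d ->
    idem a -> idem b -> idem c -> idem d -> orth a c -> orth b d ->
  idem_iso (a + c) (b + d) -> idem_iso c d -> idem_iso a b.
Proof.
have [r] := ubnP (\rank c).
elim: r a b c d => // r IHr a b c d; rewrite ltnS => rc.
move=> Ea Eb Ec Ed aa bb cc dd [ac ca] [bd db] [u [v [Eu Ev [uv vu eu fv]]]].
move=> [p [q [Ep Eq [pq qp cp dq]]]].
have pd : p * d = p by rewrite -qp mulrA pq.
have qc : q * c = q by rewrite -pq mulrA qp.
have ubd : u * (b + d) = u by rewrite -vu mulrA uv.
have vac : v * (a + c) = v by rewrite -uv mulrA vu.
(* [D] is the block of [u] from [c] to [d], carried back to the corner at [c] by [q]. The block of
   [u * v] at [c] splits along [d] and [b] into [D * D'] and [s]. *)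
pose D := c * u * d * q; pose D' := p * d * v * c; pose s := c * u * b * v * c.
have ED : E D by rewrite /D; in_commutant.
have ED' : E D' by rewrite /D'; in_commutant.
have Es : E s by rewrite /s; in_commutant.
have DDs : D * D' + s = c.
  have -> : D * D' = c * u * d * v * c.
    by rewrite /D /D' !mulrA -(mulrA _ q p) qp -!(mulrA _ d d) dd -(mulrA _ d d) dd.
  rewrite /s -2!mulrDl -!(mulrA c) -mulrDr [u * d + _]addrC -mulrDr ubd -(mulrA c) uv.
  by rewrite mulrDr ca add0r !cc.
have cD : c * D = D by rewrite /D !mulrA cc.
have Dc : D * c = D by rewrite /D -!mulrA qc.
have cs : c * s = s by rewrite /s !mulrA cc.
have sc : s * c = s by rewrite /s -!mulrA cc.
have [[x [w [Ex Ew [xc xw wx cw wc]]]]|[e [Ee ee ce ec [e0 e1]]]] :=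
  corner_stable_range Ec ED ED' Es cc cD Dc cs sc DDs.
(* Since [t * t = 0], the inverse of [1 + t] is [1 - t]. Replacing [u] by [u * (1 + t)] turns [D]
   into the invertible [D + s * x]. *)
- pose t := b * v * c * x * p * d.
  have Et : E t by rewrite /t; in_commutant.
  have bt : b * t = t by rewrite /t !mulrA bb.
  have td : t * d = t by rewrite /t -!mulrA dd.
  have dt : d * t = 0 by rewrite -bt mulrA db mul0r.
  have tb : t * b = 0 by rewrite -td -mulrA db mulr0.
  have tt : t * t = 0 by rewrite -{1}td -mulrA dt mulr0.
  have fK z : (z - t * z) + t * (z - t * z) = z.
    by rewrite mulrBr mulrA tt mul0r subr0 subrK.
  pose u1 := u + u * t; pose v1 := v - t * v.
  have u1q : c * u1 * d * q = D + s * x.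
    rewrite /u1 mulrDr !mulrDl; congr (_ + _).
    by rewrite /t /s !mulrA -!(mulrA _ d d) dd -(mulrA _ d q) dq -(mulrA _ p q) pq -(mulrA _ x c) xc.
  have w1 : c * u1 * d * (q * w) = c by rewrite mulrA u1q xw.
  apply: (@schur_complement a b c d u1 v1 (q * w)) => //.
  + by rewrite /u1; in_commutant.
  + by rewrite /v1; in_commutant.
  + by in_commutant.
  + by rewrite /u1 mulrDl -(mulrA u t) -mulrDr /v1 fK.
  + have v1u : v1 * u = b + d - t.
      by rewrite mulrBl -mulrA vu mulrDr tb add0r td.
    rewrite /u1 mulrDr mulrA v1u mulrBl mulrDl bt dt addr0 tt subr0.
    by rewrite subrK.
  + by rewrite /u1 mulrDr mulrA eu.
  + by rewrite /v1 mulrBr fv mulrA mulrDl bt dt addr0.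
  have -> : q * w * c * u1 * d = q * (w * (c * u1 * d * q)) * p.
    by rewrite -!mulrA qp dd.
  by rewrite u1q wx qc qp.
(* The proper idempotent splits [c] as [e + e']; conjugation by [p] and [q] splits [d]
   accordingly. *)
pose e' := c - e.
have Ee' : E e' by rewrite /e'; in_commutant.
have ce' : c * e' = e' by rewrite mulrBr cc ce.
have ec' : e' * c = e' by rewrite mulrBl cc ec.
have ee0 : e * e' = 0 by rewrite mulrBr ec ee subrr.
have e'e0 : e' * e = 0 by rewrite mulrBl ce ee subrr.
have e'e' : idem e' by rewrite /idem {1}/e' mulrBl ce' ee0 subr0.
have e'c : e' != c by rewrite -subr_eq0 /e' addrAC subrr sub0r oppr_eq0.
have se : e + e' = c by rewrite addrC subrK.
have split_iso f : E f -> idem f -> c * f = f -> f * c = f ->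
    [/\ E (q * f * p), idem (q * f * p) & idem_iso f (q * f * p)].
  move=> Ef ff cf fc; split; first by in_commutant.
    by rewrite /idem -!mulrA (mulrA p) pq (mulrA c) cf (mulrA f) ff.
  exists (f * p), (q * f); split; try by in_commutant.
  split.
  - by rewrite mulrA -(mulrA f) pq fc ff.
  - by rewrite !mulrA -(mulrA q) ff.
  - by rewrite mulrA ff.
  - by rewrite -!mulrA (mulrA p) pq cf ff.
have [Ef ff ef] := split_iso e Ee ee ce ec.
have [Ef' ff' ef'] := split_iso e' Ee' e'e' ce' ec'.
set f := q * e * p in Ef ff ef; set f' := q * e' * p in Ef' ff' ef'.
have sf : f + f' = d by rewrite -mulrDl -mulrDr se qc qp.
have df : d * f = f by rewrite /f !mulrA dq.
have fd : f * d = f by rewrite /f -!mulrA pd.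
have df' : d * f' = f' by rewrite /f' !mulrA dq.
have fd' : f' * d = f' by rewrite /f' -!mulrA pd.
have ff'0 : f * f' = 0.
  by rewrite /f /f' -!mulrA (mulrA p) pq (mulrA c) ce' (mulrA e) ee0 mul0r mulr0.
have f'f0 : f' * f = 0.
  by rewrite /f /f' -!mulrA (mulrA p) pq (mulrA c) ce (mulrA e') e'e0 mul0r mulr0.
have ae : a * e = 0 by rewrite -ce mulrA ac mul0r.
have ea : e * a = 0 by rewrite -ec -mulrA ca mulr0.
have ae' : a * e' = 0 by rewrite -ce' mulrA ac mul0r.
have ea' : e' * a = 0 by rewrite -ec' -mulrA ca mulr0.
have bf : b * f = 0 by rewrite -df mulrA bd mul0r.
have fb : f * b = 0 by rewrite -fd -mulrA db mulr0.
have bf' : b * f' = 0 by rewrite -df' mulrA bd mul0r.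
have fb' : f' * b = 0 by rewrite -fd' -mulrA db mulr0.
have rk := leq_trans (mxrank_idem_lt _ _ _ _ _) rc.
clearbody e' f f'.
(* [e'] is cancelled first, then [e]; both have smaller rank than [c]. *)
apply: (IHr a b e f) => //; first exact: rk.
apply: (IHr (a + e) (b + f) e' f') => //; try by in_commutant.
- exact: rk.
- by rewrite /idem mulrDl !mulrDr aa ae ea ee addr0 add0r.
- by rewrite /idem mulrDl !mulrDr bb bf fb ff addr0 add0r.
- by rewrite /orth mulrDl mulrDr ae' ee0 ea' e'e0 !addr0.
- by rewrite /orth mulrDl mulrDr bf' ff'0 fb' f'f0 !addr0.
by rewrite -!addrA se sf; exists u, v.
Qed.
End Cancellation.

(** * Isomorphisms of permutation modules as invariant kernels *)

Section KernelDefs.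
Variables (k : fieldType) (I : Type) (A B : finType).
Variables (tA : I -> A -> A) (tB : I -> B -> B).

Definition equivariant (K : A -> B -> k) :=
  forall i a b, K (tA i a) (tB i b) = K a b.

Definition inverse_on (PA : pred A) (PB : pred B) (K : A -> B -> k) (L : B -> A -> k) :=
  forall a a', PA a -> PA a' -> \sum_(b | PB b) K a b * L b a' = (a == a')%:R.

End KernelDefs.

(* Isomorphism of the permutation modules on the invariant subsets [PA] and [PB]. *)
Definition kernel_iso (k : fieldType) (I : Type) (A B : finType)
    (tA : I -> A -> A) (tB : I -> B -> B) (PA : pred A) (PB : pred B) :=
  exists (K : A -> B -> k) (L : B -> A -> k),
    [/\ equivariant tA tB K, equivariant tB tA L,
        inverse_on PA PB K L & inverse_on PB PA L K].

Section KernelMatrix.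
Variables (k : fieldType) (Z : finType).
Implicit Types (K L : Z -> Z -> k) (P Q : pred Z).

Definition kernel_mx K : 'M[k]_#|Z| := \matrix_(i, j) K (enum_val i) (enum_val j).

Lemma kernel_mxM K L :
  kernel_mx K * kernel_mx L = kernel_mx (fun x z => \sum_y K x y * L y z).
Proof.
apply/matrixP=> i j; rewrite !mxE [RHS](reindex_onto enum_val enum_rank) /=; last first.
  by move=> y _; rewrite enum_rankK.
rewrite [RHS](eq_bigl xpredT) => [|x]; last by rewrite enum_valK eqxx.
by apply: eq_bigr => x _; rewrite !mxE.
Qed.

Lemma eq_kernel_mx K L : (forall x y, K x y = L x y) -> kernel_mx K = kernel_mx L.
Proof. by move=> KL; apply/matrixP=> i j; rewrite !mxE. Qed.

Lemma kernel_mxK (X : 'M[k]_#|Z|) :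
  kernel_mx (fun x y => X (enum_rank x) (enum_rank y)) = X.
Proof. by apply/matrixP=> i j; rewrite mxE !enum_valK. Qed.

Lemma kernel_mx_inj K L : kernel_mx K = kernel_mx L -> K =2 L.
Proof.
by move=> /matrixP E x y; have := E (enum_rank x) (enum_rank y); rewrite !mxE !enum_rankK.
Qed.

Definition diag_kernel P x y : k := (P x && (x == y))%:R.

Lemma diag_kernel_mull P L x z : \sum_y diag_kernel P x y * L y z = (P x)%:R * L x z.
Proof.
rewrite (bigD1 x) //= big1 ?addr0 => [|y /negPf]; first by rewrite /diag_kernel eqxx andbT.
by rewrite /diag_kernel eq_sym => ->; rewrite andbF mul0r.
Qed.

Lemma diag_kernel_mulr P L x z : \sum_y L x y * diag_kernel P y z = L x z * (P z)%:R.
Proof.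
rewrite (bigD1 z) //= big1 ?addr0 => [|y /negPf]; first by rewrite /diag_kernel eqxx andbT.
by rewrite /diag_kernel => ->; rewrite andbF mulr0.
Qed.

Lemma diag_kernel_mxM P Q : kernel_mx (diag_kernel P) * kernel_mx (diag_kernel Q) =
  kernel_mx (diag_kernel (predI P Q)).
Proof.
rewrite kernel_mxM; apply: eq_kernel_mx => x y; rewrite diag_kernel_mull.
by rewrite -natrM mulnb andbA.
Qed.

Lemma diag_kernel_mxD P Q : (forall x, ~~ (P x && Q x)) ->
  kernel_mx (diag_kernel P) + kernel_mx (diag_kernel Q) = kernel_mx (diag_kernel (predU P Q)).
Proof.
move=> dis; apply/matrixP=> i j; rewrite !mxE /diag_kernel /=.
by have := dis (enum_val i); case: (P _); case: (Q _); case: (_ == _) => //= _; rewrite ?addr0 ?add0r.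
Qed.

Lemma diag_kernel_mx0 P : P =1 xpred0 -> kernel_mx (diag_kernel P) = 0.
Proof. by move=> P0; apply/matrixP=> i j; rewrite !mxE /diag_kernel P0. Qed.

Variables (I : Type) (t : I -> Z -> Z) (t_inj : forall i, injective (t i)).

Definition action_mx i := kernel_mx (fun x y => (t i x == y)%:R).

(** Multiplying by [action_mx i] on the left translates the row index; on the right it translates
    the column index backwards, [t i] being bijective on a finite set. Commuting is thus invariance
    under simultaneous translation. *)
Lemma commutant_kernel_mx K : equivariant t t K <-> commutant action_mx (kernel_mx K).
Proof.
have actl i x z : \sum_y (t i x == y)%:R * K y z = K (t i x) z.
  rewrite (bigD1 (t i x)) //= eqxx mul1r big1 ?addr0 // => y /negPf.
  by rewrite eq_sym => ->; rewrite mul0r.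
have actr i x z : \sum_y K x y * (t i y == t i z)%:R = K x z.
  rewrite (bigD1 z) //= eqxx mulr1 big1 ?addr0 // => y /negPf.
  by rewrite (inj_eq (@t_inj i)) => ->; rewrite mulr0.
split=> [eqK i|comK i x y].
  rewrite /GRing.comm !kernel_mxM; apply: eq_kernel_mx => x z; rewrite actl.
  have [t' _ t'K] := injF_bij (@t_inj i); rewrite -(t'K z).
  by rewrite actr eqK.
have := comK i; rewrite /GRing.comm !kernel_mxM => /kernel_mx_inj/(_ x (t i y)).
by rewrite actl actr.
Qed.

End KernelMatrix.

Section KernelCancellation.
Variables (k : fieldType) (I : Type) (A B : finType).
Variables (tA : I -> A -> A) (tB : I -> B -> B).
Hypothesis tA_inj : forall i, injective (tA i).
Hypothesis tB_inj : forall i, injective (tB i).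
Local Notation Z := (A + B)%type.

(** The disjoint union places both permutation modules in one matrix algebra, where idempotents can
    be cancelled. *)
Definition sum_act i (z : Z) : Z :=
  match z with inl a => inl (tA i a) | inr b => inr (tB i b) end.

Lemma sum_act_inj i : injective (sum_act i).
Proof. by move=> [a|b] [a'|b'] //= [] => [/tA_inj|/tB_inj] ->. Qed.

Definition on_left (P : pred A) : pred Z := fun z => if z is inl a then P a else false.
Definition on_right (P : pred B) : pred Z := fun z => if z is inr b then P b else false.

Local Notation MZ := (@action_mx k _ I sum_act).
Local Notation eA P := (kernel_mx (diag_kernel k (on_left P))).
Local Notation eB P := (kernel_mx (diag_kernel k (on_right P))).

Lemma commutant_diag (P : pred Z) : (forall i z, P (sum_act i z) = P z) ->
  commutant MZ (kernel_mx (diag_kernel k P)).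
Proof.
move=> stP; apply/commutant_kernel_mx; first exact: sum_act_inj.
by move=> i x y; rewrite /diag_kernel stP (inj_eq (@sum_act_inj i)).
Qed.

(** Kernels are off-diagonal blocks of matrices on [A + B]. Their values outside [PA] and [PB] are
    unconstrained, so they are cut to zero one way; conversely, [u * eB PB = u] and [v * eA PA = v]
    confine the sums to [PB] and [PA]. *)
Lemma kernel_isoP (PA : pred A) (PB : pred B) :
    (forall i a, PA (tA i a) = PA a) -> (forall i b, PB (tB i b) = PB b) ->
  kernel_iso k tA tB PA PB <-> idem_iso MZ (eA PA) (eB PB).
Proof.
move=> stA stB; split=> [[K [L [eqK eqL KL LK]]]|].
  pose U (x y : Z) : k :=
    match x, y with inl a, inr b => (PA a && PB b)%:R * K a b | _, _ => 0 end.
  pose V (x y : Z) : k :=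
    match x, y with inr b, inl a => (PA a && PB b)%:R * L b a | _, _ => 0 end.
  exists (kernel_mx U), (kernel_mx V); split.
  - apply/commutant_kernel_mx; first exact: sum_act_inj.
    by move=> i [a|b] [a'|b'] //=; rewrite stA stB eqK.
  - apply/commutant_kernel_mx; first exact: sum_act_inj.
    by move=> i [a|b] [a'|b'] //=; rewrite stA stB eqL.
  split.
  - rewrite kernel_mxM; apply: eq_kernel_mx => x y.
    rewrite big_sumType /= big1 ?add0r => [|a _]; last first.
      by case: x => [a'|b'] /=; rewrite mul0r.
    case: x => [a|b]; last by rewrite big1 // => b' _; rewrite mul0r.
    case: y => [a'|b]; last first.
      by rewrite /diag_kernel andbF big1 // => b' _; rewrite mulr0.
    rewrite /diag_kernel (inj_eq (@inl_inj A B)) /=.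
    have [PAa|_] := boolP (PA a); last by rewrite big1 // => b' _; rewrite !mul0r.
    have [PAa'|NPAa'] := boolP (PA a'); last first.
      rewrite big1 => [|b' _]; last by rewrite mul0r mulr0.
      by case: (a =P a') NPAa' => [<-|]; rewrite ?PAa ?andbF.
    rewrite -KL // [RHS]big_mkcond; apply: eq_bigr => b _ /=.
    by case: (PB b); rewrite ?mul1r ?mul0r.
  - rewrite kernel_mxM; apply: eq_kernel_mx => x y.
    rewrite big_sumType /= addrC big1 ?add0r => [|a _]; last first.
      by case: x => [a'|b'] /=; rewrite mul0r.
    case: x => [b|a]; first by rewrite big1 // => b' _; rewrite mul0r.
    case: y => [b|a'].
      by rewrite /diag_kernel andbF big1 // => b' _; rewrite mulr0.
    rewrite /diag_kernel (inj_eq (@inr_inj A B)) /=.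
    have [PAa|_] := boolP (PB a); last by rewrite big1 // => b' _; rewrite andbF !mul0r.
    have [PAa'|NPAa'] := boolP (PB a'); last first.
      rewrite big1 => [|b' _]; last by rewrite andbF mul0r mulr0.
      by case: (a =P a') NPAa' => [<-|]; rewrite ?PAa ?andbF.
    rewrite -LK // [RHS]big_mkcond; apply: eq_bigr => b _ /=.
    by case: (PA b); rewrite ?mul1r ?mul0r.
  - rewrite kernel_mxM; apply: eq_kernel_mx => -[a|b] [a'|b']; rewrite diag_kernel_mull /= ?mulr0 ?mul0r //.
    by case: (PA a); rewrite ?mul1r ?mul0r.
  - rewrite kernel_mxM; apply: eq_kernel_mx => -[a|b] [a'|b']; rewrite diag_kernel_mull /= ?mulr0 ?mul0r //.
    by case: (PB b); rewrite ?mul1r ?andbF ?mul0r.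
case=> u [v [Eu Ev [uv vu eu fv]]].
have uf : u * eB PB = u by rewrite -vu mulrA uv.
have ve : v * eA PA = v by rewrite -uv mulrA vu.
pose U x y := u (enum_rank x) (enum_rank y); pose V x y := v (enum_rank x) (enum_rank y).
have {}du : u = kernel_mx U by rewrite kernel_mxK.
have {}dv : v = kernel_mx V by rewrite kernel_mxK.
clearbody U V; subst u v.
exists (fun a b => U (inl a) (inr b)), (fun b a => V (inr b) (inl a)); split.
- by move=> i a b; apply: ((commutant_kernel_mx sum_act_inj _).2 Eu i (inl a) (inr b)).
- by move=> i b a; apply: ((commutant_kernel_mx sum_act_inj _).2 Ev i (inr b) (inl a)).
- move=> a a' PAa PAa'; move: uv; rewrite kernel_mxM => /kernel_mx_inj/(_ (inl a) (inl a')).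
  rewrite /diag_kernel (inj_eq (@inl_inj A B)) /= PAa => <-.
  move: uf; rewrite kernel_mxM => /kernel_mx_inj uf.
  rewrite big_sumType /= [X in _ = X + _]big1 ?add0r => [|a1 _]; last first.
    by rewrite -uf diag_kernel_mulr /= mulr0 mul0r.
  rewrite big_mkcond; apply: eq_bigr => b _ /=.
  case: ifPn => // PBb; rewrite -uf diag_kernel_mulr /= (negPf PBb) mulr0 mul0r //.
- move=> a a' PAa PAa'; move: vu; rewrite kernel_mxM => /kernel_mx_inj/(_ (inr a) (inr a')).
  rewrite /diag_kernel (inj_eq (@inr_inj A B)) /= PAa => <-.
  move: ve; rewrite kernel_mxM => /kernel_mx_inj ve.
  rewrite big_sumType /= [X in _ = _ + X]big1 ?addr0 => [|a1 _]; last first.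
    by rewrite -ve diag_kernel_mulr /= mulr0 mul0r.
  rewrite big_mkcond; apply: eq_bigr => b _ /=.
  case: ifPn => // PBb; rewrite -ve diag_kernel_mulr /= (negPf PBb) mulr0 mul0r //.
Qed.

Theorem kernel_cancel (PA : pred A) (PB : pred B) :
    (forall i a, PA (tA i a) = PA a) -> (forall i b, PB (tB i b) = PB b) ->
  kernel_iso k tA tB xpredT xpredT -> kernel_iso k tA tB (predC PA) (predC PB) ->
  kernel_iso k tA tB PA PB.
Proof.
move=> stA stB isoT isoC.
have stAC i a : predC PA (tA i a) = predC PA a by rewrite /= stA.
have stBC i b : predC PB (tB i b) = predC PB b by rewrite /= stB.
have eqM P Q : P =1 Q -> kernel_mx (diag_kernel k P) = kernel_mx (diag_kernel k Q) :> 'M_#|{: Z}|.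
  by move=> PQ; apply: eq_kernel_mx => x y; rewrite /diag_kernel PQ.
apply/kernel_isoP => //; apply: (@idem_cancel _ _ _ _ _ _ (eA (predC PA)) (eB (predC PB))).
- by apply: commutant_diag => i [z|z] /=; rewrite ?stA ?stB.
- by apply: commutant_diag => i [z|z] /=; rewrite ?stA ?stB.
- by apply: commutant_diag => i [z|z] /=; rewrite ?stA ?stB.
- by apply: commutant_diag => i [z|z] /=; rewrite ?stA ?stB.
- by rewrite /idem diag_kernel_mxM; apply: eqM => z /=; rewrite andbb.
- by rewrite /idem diag_kernel_mxM; apply: eqM => z /=; rewrite andbb.
- by rewrite /idem diag_kernel_mxM; apply: eqM => z /=; rewrite andbb.
- by rewrite /idem diag_kernel_mxM; apply: eqM => z /=; rewrite andbb.
- by split; rewrite diag_kernel_mxM; apply: diag_kernel_mx0 => -[a|b] //=; rewrite (andbN, andNb).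
- by split; rewrite diag_kernel_mxM; apply: diag_kernel_mx0 => -[a|b] //=; rewrite (andbN, andNb).
- rewrite !diag_kernel_mxD; last 2 first.
  + by case=> [a|b] //=; rewrite andbN.
  + by case=> [a|b] //=; rewrite andbN.
  rewrite [X in idem_iso _ X](eqM _ (on_left xpredT)); last by case=> [a|b] //=; rewrite orbN.
  rewrite [X in idem_iso _ _ X](eqM _ (on_right xpredT)); last by case=> [a|b] //=; rewrite orbN.
  exact/kernel_isoP.
exact/kernel_isoP.
Qed.

End KernelCancellation.

(** Choice below a bound, by recursion on it: each round overrides the family at one index, with a
    cast because [U l] depends on [l]. *)
Lemma bounded_choice (U : nat -> Type) (P : forall l, U l -> Prop) m :
    (forall l, U l) -> (forall l, (l < m)%N -> exists u, P l u) ->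
  exists u, forall l, (l < m)%N -> P l (u l).
Proof.
move=> u0; elim: m => [|m IHm] exP; first by exists u0.
have [l lm|u uP] := IHm; first exact/exP/ltnW.
have [v vP] := exP m (leqnn _).
exists (fun l => if m =P l is ReflectT e then eq_rect m U v l e else u l) => l.
case: eqP => [eml _|/eqP nml lm]; first by case: l / eml.
by apply: uP; rewrite ltn_neqAle eq_sym nml.
Qed.

(** * Fibres of maps and their sections *)

Section Fibres.
Variables (T : finType) (X Y : finType).
Implicit Types (f : {ffun T -> X}) (g : {ffun T -> Y}).

(** [pick] sees only the predicate, so maps with the same fibres receive the same
    representatives. *)
Definition fibre_rep f i := odflt i [pick j | f j == f i].
Definition fibre_reps f : {set T} := [set fibre_rep f i | i : T].

Lemma fibre_repP f i : f (fibre_rep f i) = f i.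
Proof. by rewrite /fibre_rep; case: pickP => [j /eqP|]. Qed.

Lemma eq_fibre_rep f i j : f i = f j -> fibre_rep f i = fibre_rep f j.
Proof.
rewrite /fibre_rep => eqf; rewrite eqf.
by case: pickP => // /(_ j); rewrite eqxx.
Qed.

Definition is_section f l (s : 'I_l -> T) :=
  injective (f \o s) /\ forall i, exists j, f (s j) = f i.

Lemma fibre_reps_section f : is_section f (@enum_val T (mem (fibre_reps f))).
Proof.
split=> [j j' /= eqf|i].
  apply: enum_val_inj.
  have /imsetP[i _ di] := enum_valP j; have /imsetP[i' _ di'] := enum_valP j'.
  move: eqf; rewrite di di' !fibre_repP.
  exact: eq_fibre_rep.
have Ai : fibre_rep f i \in fibre_reps f by apply: imset_f.
by exists (enum_rank_in Ai (fibre_rep f i)); rewrite enum_rankK_in // fibre_repP.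
Qed.

Lemma section_retraction f l (s : 'I_l -> T) : is_section f s ->
  exists r : T -> 'I_l, (forall i, f (s (r i)) = f i) /\ cancel s r.
Proof.
move=> [inj_s surj_s].
have [r rP] := @fin_all_exists _ _ (fun i j => f (s j) = f i) surj_s.
by exists r; split=> // j; apply: inj_s; rewrite /= rP.
Qed.

(** Composing each section with the retraction onto the other gives injections both ways; these
    force equal sizes and supply the relabelling [p]. *)
Lemma section_unique f l l' (s : 'I_l -> T) (s' : 'I_l' -> T) :
    is_section f s -> is_section f s' ->
  l = l' /\ exists2 p : 'I_l -> 'I_l', injective p & forall j, f (s' (p j)) = f (s j).
Proof.
move=> ss ss'; have [r [rP _]] := section_retraction ss.
have [r' [rP' _]] := section_retraction ss'.
have injp : injective (r' \o s).
  by move=> j j' /= eqr; apply: ss.1; rewrite /= -rP' eqr rP'.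
have injp' : injective (r \o s').
  by move=> j j' /= eqr; apply: ss'.1; rewrite /= -rP eqr rP.
split; last by exists (r' \o s) => // j; apply: rP'.
by apply/eqP; rewrite eqn_leq; apply/andP; split;
  [have := leq_card _ injp | have := leq_card _ injp']; rewrite !card_ord.
Qed.

Definition same_fibres f g := [forall i, forall j, (f i == f j) == (g i == g j)].

Lemma same_fibresP f g :
  reflect (forall i j, (f i == f j) = (g i == g j)) (same_fibres f g).
Proof.
apply: (iffP forallP) => [fg i j|fg i]; first by have /forallP/(_ j)/eqP := fg i.
by apply/forallP=> j; apply/eqP.
Qed.

Lemma same_fibres_eq f g i j : same_fibres f g -> f i = f j -> g i = g j.
Proof. by move=> /same_fibresP fg /eqP; rewrite fg => /eqP. Qed.

Lemma same_fibres_injectiveb f g : same_fibres f g -> injectiveb f = injectiveb g.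
Proof.
move=> /same_fibresP fg; apply/injectiveP/injectiveP => inj i j /eqP.
  by rewrite -fg => /eqP/inj.
by rewrite fg => /eqP/inj.
Qed.

Lemma card_fibre_reps f : ~~ injectiveb f -> (#|fibre_reps f| < #|T|)%N.
Proof.
move=> ninj; rewrite ltn_neqAle max_card andbT; apply: contra ninj => /eqP cardT.
have inj_rep : {in T &, injective (fibre_rep f)} by apply/imset_injP/eqP.
by apply/injectiveP => i j /eq_fibre_rep/inj_rep; apply; rewrite inE.
Qed.

Definition restrict f (A : {set T}) : {ffun 'I_#|A| -> X} :=
  [ffun j => f (enum_val j)].

End Fibres.

Lemma same_fibres_sym (T X Y : finType) (f : {ffun T -> X}) (g : {ffun T -> Y}) :
  same_fibres f g = same_fibres g f.
Proof. by apply/same_fibresP/same_fibresP => fg i j; rewrite fg. Qed.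

Lemma same_fibres_trans (T X Y W : finType)
    (f : {ffun T -> X}) (g : {ffun T -> Y}) (h : {ffun T -> W}) :
  same_fibres f g -> same_fibres g h -> same_fibres f h.
Proof. by move=> /same_fibresP fg /same_fibresP gh; apply/same_fibresP=> i j; rewrite fg gh. Qed.

Lemma same_fibres_reps (T X Y : finType) (f : {ffun T -> X}) (g : {ffun T -> Y}) :
  same_fibres f g -> fibre_reps f = fibre_reps g.
Proof.
move=> /same_fibresP fg; apply: eq_imset => i; rewrite /fibre_rep.
by rewrite (eq_pick (Q := fun j => g j == g i)) // => j; apply: fg.
Qed.

(** * Kernels on functions and on injective functions *)

Section FunctionKernels.
Variables (k : fieldType) (J : Type).

Definition ffun_act (X T : finType) (t : J -> X -> X) (c : J * {perm T})
    (f : {ffun T -> X}) : {ffun T -> X} := [ffun i => t c.1 (f (c.2 i))].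

Lemma ffun_act_inj (X T : finType) (t : J -> X -> X) :
  (forall j, injective (t j)) -> forall c, injective (@ffun_act X T t c).
Proof.
move=> t_inj c f g /ffunP fg; apply/ffunP => i.
by have := fg ((c.2^-1)%g i); rewrite !ffunE permKV => /t_inj.
Qed.

Lemma injectiveb_ffun_act (X T : finType) (t : J -> X -> X) :
    (forall j, injective (t j)) -> forall c (f : {ffun T -> X}),
  injectiveb (ffun_act t c f) = injectiveb f.
Proof.
move=> t_inj c f; apply/injectiveP/injectiveP => inj i j eqf.
  have := inj ((c.2^-1)%g i) ((c.2^-1)%g j); rewrite !ffunE !permKV eqf.
  by move=> /(_ erefl)/perm_inj.
by move: eqf; rewrite !ffunE => /t_inj/inj/perm_inj.
Qed.

Definition tensor_kernel (X Y T : finType) (K : X -> Y -> k)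
    (f : {ffun T -> X}) (g : {ffun T -> Y}) : k := \prod_i K (f i) (g i).

(** Tensor powers of inverse matrices are inverse: the sum over all [g] of a product is a product of
    sums, each a Kronecker delta. *)
Lemma tensor_power_iso (X Y T : finType) (tX : J -> X -> X) (tY : J -> Y -> Y) :
    kernel_iso k tX tY xpredT xpredT ->
  kernel_iso k (@ffun_act X T tX) (@ffun_act Y T tY) xpredT xpredT.
Proof.
have half (X1 Y1 : finType) (K : X1 -> Y1 -> k) L : inverse_on xpredT xpredT K L ->
    inverse_on xpredT xpredT (@tensor_kernel X1 Y1 T K) (@tensor_kernel Y1 X1 T L).
  move=> KL f h _ _; under eq_bigr => g _ do rewrite -big_split /=.
  rewrite -(bigA_distr_bigA (fun i y => K (f i) y * L y (h i))) /=.
  under eq_bigr => i _ do rewrite KL //.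
  have [<-|/eqP/ffunP nfh] := eqVneq f h; first by rewrite big1 // => i _; rewrite eqxx.
  apply/eqP/prodf_eq0; have /forallPn[i fhi] : ~~ [forall i, f i == h i].
    by apply/negP => /forallP fh; apply: nfh => i; apply/eqP.
  by exists i => //; rewrite (negPf fhi).
have equiv (X1 Y1 : finType) (t1 : J -> X1 -> X1) (t2 : J -> Y1 -> Y1) K :
    equivariant t1 t2 K ->
    equivariant (@ffun_act X1 T t1) (@ffun_act Y1 T t2) (tensor_kernel K).
  move=> eqK c f g; rewrite /tensor_kernel [RHS](reindex_inj (@perm_inj _ c.2)) /=.
  by apply: eq_bigr => i _; rewrite !ffunE eqK.
move=> [K [L [eqK eqL KL LK]]].
exists (tensor_kernel K), (tensor_kernel L).
by split; [exact: equiv | exact: equiv | exact: half | exact: half].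
Qed.

Definition kernel_family (X Y : finType) :=
  forall l, {ffun 'I_l -> X} -> {ffun 'I_l -> Y} -> k.

(** A block matrix on non-injective functions, one block per partition into fibres. Within a block
    both functions descend to injective ones on the representatives, where a smaller kernel
    applies. *)
Definition glue (X Y : finType) (K : kernel_family X Y) m
    (f : {ffun 'I_m -> X}) (g : {ffun 'I_m -> Y}) : k :=
  if ~~ injectiveb f && same_fibres f g
  then K _ (restrict f (fibre_reps f)) (restrict g (fibre_reps f)) else 0.

Local Notation injb := (fun f : {ffun _ -> _} => injectiveb f).

Lemma same_fibres_act (X Y T : finType) (tX : J -> X -> X) (tY : J -> Y -> Y) c
    (f : {ffun T -> X}) (g : {ffun T -> Y}) :
    (forall j, injective (tX j)) -> (forall j, injective (tY j)) ->
  same_fibres (ffun_act tX c f) (ffun_act tY c g) = same_fibres f g.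
Proof.
move=> tX_inj tY_inj; apply/same_fibresP/same_fibresP => fg i j.
  have := fg ((c.2^-1)%g i) ((c.2^-1)%g j).
  by rewrite !ffunE !permKV (inj_eq (@tX_inj _)) (inj_eq (@tY_inj _)).
by rewrite !ffunE (inj_eq (@tX_inj _)) (inj_eq (@tY_inj _)).
Qed.

(** The sizes will count representatives of two different functions, hence two variables. Once
    identified, [p] is a permutation and equivariance of [K l] applies. *)
Lemma family_reindex (X Y : finType) (tX : J -> X -> X) (tY : J -> Y -> Y)
    (K : kernel_family X Y) c l l' (p : 'I_l -> 'I_l')
    (f : {ffun 'I_l' -> X}) (g : {ffun 'I_l' -> Y}) :
    equivariant (@ffun_act X _ tX) (@ffun_act Y _ tY) (K l) ->
    l = l' -> injective p ->
  K l [ffun j => tX c (f (p j))] [ffun j => tY c (g (p j))] = K l' f g.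
Proof.
move=> eqK ll'; case: l' / ll' p f g => p f g p_inj.
rewrite -(eqK (c, perm p_inj) f g); congr (K l _ _); apply/ffunP=> j.
  by rewrite !ffunE /= permE.
by rewrite !ffunE /= permE.
Qed.

(** Permuting arguments need not preserve the chosen representatives. Those of the translate, moved
    by [c.2], are another section of [f]; [section_unique] relabels it, and equivariance of the
    smaller kernel absorbs the relabelling. *)
Lemma glue_equivariant (X Y : finType) (tX : J -> X -> X) (tY : J -> Y -> Y)
    (K : kernel_family X Y) m :
    (forall j, injective (tX j)) -> (forall j, injective (tY j)) ->
    (forall l, (l < m)%N -> equivariant (@ffun_act X _ tX) (@ffun_act Y _ tY) (K l)) ->
  equivariant (@ffun_act X _ tX) (@ffun_act Y _ tY) (@glue X Y K m).
Proof.
move=> tX_inj tY_inj eqK c f g.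
rewrite /glue same_fibres_act // injectiveb_ffun_act //.
case: ifPn => // /andP[ninj fg]; set f' := ffun_act tX c f.
have ss' := fibre_reps_section f'; have ss := fibre_reps_section f.
pose s (j : 'I_#|fibre_reps f'|) := c.2 (enum_val j).
have {}ss' : is_section f s.
  case: ss' => inj_s surj_s; split=> [j j' /= eqf|i].
    by apply: inj_s; rewrite /= !ffunE eqf.
  have [j] := surj_s ((c.2^-1)%g i); rewrite !ffunE permKV => /tX_inj.
  by exists j.
have [eql [p p_inj pP]] := section_unique ss' ss.
rewrite -[RHS](family_reindex (tX := tX) (tY := tY) c.1 _ _ _ eql p_inj).
  congr (K _ _ _); apply/ffunP=> j; rewrite !ffunE.
    by rewrite pP.
  by rewrite (same_fibres_eq fg (pP j)).
apply: eqK; rewrite -[m in leqRHS]card_ord card_fibre_reps // injectiveb_ffun_act //.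
Qed.

(** Functions [g] with the fibres of [f] correspond to injective functions on the representatives,
    so the sum becomes that of the smaller kernels. If [f] and [h] have different fibres, every term
    vanishes. *)
Lemma glue_inverse (X Y : finType) (K : kernel_family X Y) (L : kernel_family Y X) m :
    (forall l, (l < m)%N -> inverse_on injb injb (K l) (L l)) ->
  inverse_on (predC injb) (predC injb) (@glue X Y K m) (@glue Y X L m).
Proof.
move=> KL f h /= nf nh.
have [fh|nfh] := boolP (same_fibres f h); last first.
  have [efh|_] := eqVneq f h.
    by case/negP: nfh; rewrite efh; apply/same_fibresP.
  rewrite big1 // => g _; rewrite /glue nf.
  case: ifPn => [/= fg|_]; last by rewrite mul0r.
  case: ifPn => [/andP[_ gh]|_]; last by rewrite mulr0.
  by case/negP: nfh; apply: same_fibres_trans fg gh.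
have lt_m : (#|fibre_reps f| < m)%N by rewrite -[m in leqRHS]card_ord card_fibre_reps.
have ss := fibre_reps_section f; have [inj_s _] := ss.
have [r [rP rK]] := section_retraction ss.
set s := enum_val in ss rP rK inj_s.
pose A := fibre_reps f.
transitivity (\sum_(g | same_fibres f g) K _ (restrict f A) (restrict g A) *
                                    L _ (restrict g A) (restrict h A)).
  rewrite big_mkcond [RHS]big_mkcond; apply: eq_bigr => g _ /=.
  rewrite /glue nf /=; have [fg|_] := boolP (same_fibres f g); last by rewrite mul0r if_same.
  rewrite -(same_fibres_injectiveb fg) nf -(same_fibres_reps fg).
  by rewrite (@same_fibres_trans _ _ _ _ g f h) // same_fibres_sym.
rewrite (reindex_onto (fun g' : {ffun 'I_#|A| -> Y} => [ffun i => g' (r i)])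
                      (fun g => restrict g A)) /=; last first.
  by move=> g fg; apply/ffunP=> i; rewrite !ffunE; apply: same_fibres_eq fg (rP i).
have extK (g' : {ffun 'I_#|A| -> Y}) : restrict [ffun i => g' (r i)] A = g'.
  by apply/ffunP=> j; rewrite !ffunE rK.
under eq_bigl => g' do rewrite extK eqxx andbT.
under eq_bigr => g' _ do rewrite extK.
have sameE (g' : {ffun 'I_#|A| -> Y}) : same_fibres f [ffun i => g' (r i)] = injectiveb g'.
  apply/same_fibresP/injectiveP => [fg j j' eqg|inj i i'].
    apply: inj_s; apply/eqP; rewrite /= fg !ffunE !rK; exact/eqP.
  rewrite !ffunE (inj_eq inj); apply/eqP/eqP => [eqf|eqr].
    by apply: inj_s; rewrite /= !rP.
  by rewrite -rP eqr rP.
rewrite (eq_bigl _ _ sameE) KL //.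
- congr (nat_of_bool _)%:R; apply/eqP/eqP => [/ffunP efh|->] //.
  apply/ffunP=> i; have := efh (r i); rewrite !ffunE -/s rP => ->.
  exact: same_fibres_eq fh (rP i).
- by apply/injectiveP=> j j'; rewrite !ffunE => /inj_s.
- apply/injectiveP=> j j'; rewrite !ffunE => eqh; apply: inj_s => /=.
  by apply: (same_fibres_eq (g := f) _ eqh); rewrite same_fibres_sym.
Qed.

Theorem injective_functions_iso (X Y : finType) (tX : J -> X -> X) (tY : J -> Y -> Y) m :
    (forall j, injective (tX j)) -> (forall j, injective (tY j)) ->
    kernel_iso k tX tY xpredT xpredT ->
  kernel_iso k (@ffun_act X _ tX) (@ffun_act Y _ tY)
    (fun f : {ffun 'I_m -> X} => injectiveb f) (fun f : {ffun 'I_m -> Y} => injectiveb f).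
Proof.
move=> tX_inj tY_inj isoXY; elim/ltn_ind: m => m IHm.
apply: kernel_cancel.
- exact: ffun_act_inj.
- exact: ffun_act_inj.
- by move=> c f; apply: injectiveb_ffun_act.
- by move=> c f; apply: injectiveb_ffun_act.
- exact: tensor_power_iso.
pose U l := (({ffun 'I_l -> X} -> {ffun 'I_l -> Y} -> k) *
             ({ffun 'I_l -> Y} -> {ffun 'I_l -> X} -> k))%type.
pose P l (u : U l) :=
  [/\ equivariant (@ffun_act X _ tX) (@ffun_act Y _ tY) u.1,
      equivariant (@ffun_act Y _ tY) (@ffun_act X _ tX) u.2,
      inverse_on injb injb u.1 u.2 & inverse_on injb injb u.2 u.1].
(* The zero kernels fill the sizes from [m] on; a non-injective function on [m] points has fewer
   than [m] fibres. *)
have [] := @bounded_choice U P m (fun _ => (fun _ _ => 0, fun _ _ => 0)).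
  by move=> l /IHm[K [L KL]]; exists (K, L).
move=> u uP; pose K : kernel_family X Y := fun l => (u l).1.
pose L : kernel_family Y X := fun l => (u l).2.
exists (@glue X Y K m), (@glue Y X L m); split.
- by apply: glue_equivariant => // l /uP[].
- by apply: glue_equivariant => // l /uP[].
- by apply: glue_inverse => l /uP[].
- by apply: glue_inverse => l /uP[].
Qed.

End FunctionKernels.

(** * Linear maps between permutation modules as kernels *)

Section LinearMapKernels.
Variables (k : fieldType) (gT : finGroupType).

(** The multiple of a group element by a scalar: scalars of [k] enter with [g = 1], translations
    with [c = 1], as linearity is over the group algebra. *)
Definition galg_elem (c : k) (g : gT) : group_algebra k gT :=
  [ffun h : gT => c * (h == g)%:R].

Lemma galg_elem_scaleE (Z : finType) (to : {action gT &-> Z}) c g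
    (f : perm_module k to) z : (galg_elem c g *: f) z = c * f (to z g).
Proof.
rewrite ffunE (bigD1 g) //= big1 ?addr0 => [|h /negPf hg]; rewrite ffunE.
  by rewrite eqxx mulr1.
by rewrite hg mulr0 mul0r.
Qed.

Definition delta (Z : finType) (to : {action gT &-> Z}) (x : Z) : perm_module k to :=
  [ffun z : Z => (x == z)%:R].

Variables (X Y : finType) (toX : {action gT &-> X}) (toY : {action gT &-> Y}).
Variable phi : {linear perm_module k toX -> perm_module k toY}.

Lemma linear_kernelE f y : phi f y = \sum_x f x * phi (delta toX x) y.
Proof.
have {1}-> : f = \sum_x galg_elem (f x) 1%g *: delta toX x.
  apply/ffunP=> z; rewrite sum_ffunE (bigD1 z) //= big1 ?addr0 => [|x /negPf xz].
    by rewrite galg_elem_scaleE act1 ffunE eqxx mulr1.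
  by rewrite galg_elem_scaleE act1 ffunE xz mulr0.
rewrite linear_sum sum_ffunE; apply: eq_bigr => x _.
by rewrite linearZ /= galg_elem_scaleE act1.
Qed.

Lemma linear_kernel_equivariant g x y :
  phi (delta toX (toX x g)) (toY y g) = phi (delta toX x) y.
Proof.
have -> : delta toX x = galg_elem 1 g *: delta toX (toX x g).
  by apply/ffunP=> z; rewrite galg_elem_scaleE !ffunE mul1r (inj_eq (act_inj toX g)).
by rewrite linearZ /= galg_elem_scaleE mul1r.
Qed.

End LinearMapKernels.

Lemma linearly_equivalent_kernel_iso (k : fieldType) (gT : finGroupType) (X Y : finType)
    (toX : {action gT &-> X}) (toY : {action gT &-> Y}) :
    linearly_equivalent k toX toY ->
  kernel_iso k (fun g x => toX x g) (fun g y => toY y g) xpredT xpredT.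
Proof.
case=> phi [psi phiK psiK].
pose lin := GRing.isLinear.Build _ _ _ _ psi (can2_linear phiK psiK).
pose psiL : {linear perm_module k toY -> perm_module k toX} := HB.pack psi lin.
exists (fun x y => phi (delta k toX x) y), (fun y x => psiL (delta k toY y) x); split.
- by move=> g x y; apply: linear_kernel_equivariant.
- by move=> g y x; apply: linear_kernel_equivariant.
- by move=> x x' _ _; rewrite -linear_kernelE /= phiK ffunE.
- by move=> x x' _ _; rewrite -linear_kernelE /= psiK ffunE.
Qed.

(** * Kernels descending to coset spaces *)

Section CosetKernels.
Variables (k : fieldType) (S : finGroupType).
Implicit Types G H : {group S}.

Lemma rcoset_in_rcosets H x : (H :* x)%g \in rcosets H [set: S].
Proof. by apply/rcosetsP; exists x; rewrite ?inE. Qed.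

Definition coset_pt H (x : S) : coset_space H := Sub (H :* x)%g (rcoset_in_rcosets H x).

Lemma coset_ptM H x y : coset_fun (coset_pt H x) y = coset_pt H (x * y)%g.
Proof. by apply: val_inj; rewrite /= rcosetM. Qed.

Lemma coset_ptP H (C : coset_space H) : exists x, C = coset_pt H x.
Proof.
have /rcosetsP[x _ dC] := valP C.
by exists x; apply: val_inj.
Qed.

Lemma coset_ptMl H h x : h \in H -> coset_pt H (h * x)%g = coset_pt H x.
Proof. by move=> Hh; apply: val_inj; rewrite /= rcosetM (rcoset_id Hh). Qed.

(* Left translation by [G], resp. [H], need only preserve the kernel when both
   variables are translated at the same time: summing over the whole group [S]
   then produces a function on right cosets of [H]. *)
Definition transfers G H (K : S -> S -> k) :=
  forall h, h \in H -> exists2 g, g \in G &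
    forall x y, K (g * x)%g (h * y)%g = K x y.

Definition right_invariant (K : S -> S -> k) :=
  forall x y z, K (x * z)%g (y * z)%g = K x y.

(** [F] is read as a function on [S] constant on cosets of [G], to which [K] is applied. Nothing is
    averaged, so no group order is inverted in [k]. *)
Definition coset_map G H (K : S -> S -> k)
    (F : perm_module k (coset_action G)) : perm_module k (coset_action H) :=
  [ffun C : coset_space H => \sum_x K x (repr (val C)) * F (coset_pt G x)].

Section OneKernel.
Variables (G H : {group S}) (K : S -> S -> k).
Hypotheses (K_transfers : transfers G H K) (K_right : right_invariant K).

(** Another representative [h * y] is compensated by substituting [g * x] for [x], which does not
    change the coset of [x]. *)
Lemma coset_mapE F y : coset_map H K F (coset_pt H y) = \sum_x K x y * F (coset_pt G x).
Proof.
rewrite ffunE /=; have /rcosetP[h Hh ->] := mem_repr_rcoset H y.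
have [g Gg Kgh] := K_transfers Hh.
rewrite (reindex_inj (mulgI g)) /=; apply: eq_bigr => x _.
by rewrite Kgh coset_ptMl.
Qed.

Lemma coset_map_linear : linear (@coset_map G H K : perm_module k (coset_action G) ->
  perm_module k (coset_action H)).
Proof.
move=> a F F'; apply/ffunP=> C; have [y ->] := coset_ptP C.
rewrite coset_mapE ffunE [in RHS]ffunE coset_mapE.
under eq_bigr do rewrite ffunE mulrDr ffunE mulr_sumr.
rewrite big_split exchange_big /=; congr (_ + _); apply: eq_bigr => g _.
rewrite coset_ptM coset_mapE mulr_sumr [RHS](reindex_inj (mulIg g)) /=.
by apply: eq_bigr => x _; rewrite K_right coset_ptM mulrCA.
Qed.

End OneKernel.

Lemma coset_mapK G H K L : transfers G H K -> transfers H G L ->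
    (forall x z, \sum_y K x y * L y z = (x == z)%:R) ->
  cancel (@coset_map G H K) (@coset_map H G L).
Proof.
move=> trK trL KL F; apply/ffunP=> C; have [z ->] := coset_ptP C.
rewrite coset_mapE //; under eq_bigr do rewrite coset_mapE // mulr_sumr.
rewrite exchange_big (bigD1 z) //= [X in _ + X]big1 => [|x /negPf xz].
  rewrite addr0; under eq_bigr do rewrite mulrCA mulrA.
  by rewrite -mulr_suml KL eqxx mul1r.
under eq_bigr do rewrite mulrCA mulrA.
by rewrite -mulr_suml KL xz mul0r.
Qed.

Lemma linearly_equivalent_cosets G H K L :
    transfers G H K -> transfers H G L -> right_invariant K ->
    (forall x z, \sum_y K x y * L y z = (x == z)%:R) ->
    (forall x z, \sum_y L x y * K y z = (x == z)%:R) ->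
  linearly_equivalent k (coset_action G) (coset_action H).
Proof.
move=> trK trL rK KL LK.
pose lin := GRing.isLinear.Build _ _ _ _ (@coset_map G H K) (coset_map_linear trK rK).
pose phi : {linear perm_module k (coset_action G) -> perm_module k (coset_action H)} :=
  HB.pack (@coset_map G H K) lin.
by exists phi; exists (@coset_map H G L); apply: coset_mapK.
Qed.

End CosetKernels.

(** * The symmetric group as the set of injective functions *)

Section PermutationFunctions.
Variables (gT : finGroupType) (n : nat) (X : finType) (to : {action gT &-> X}).
Variables (b : X -> 'I_n) (b' : 'I_n -> X) (bK : cancel b b') (b'K : cancel b' b).

(* The inverse turns right multiplication of [s] into precomposition. *)
Definition perm_ffun (s : {perm 'I_n}) : {ffun 'I_n -> X} := [ffun i => b' ((s^-1)%g i)].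

Lemma perm_ffun_inj : injective perm_ffun.
Proof.
move=> s s' /ffunP eqs; apply: invg_inj; apply/permP=> i.
by have := eqs i; rewrite !ffunE => /(can_inj b'K).
Qed.

Lemma injectiveb_perm_ffun s : injectiveb (perm_ffun s).
Proof.
by apply/injectiveP=> i j; rewrite !ffunE => /(can_inj b'K)/perm_inj.
Qed.

Lemma sum_perm_ffun (V : nmodType) (F : {ffun 'I_n -> X} -> V) :
  \sum_(f : {ffun 'I_n -> X} | injectiveb f) F f = \sum_s F (perm_ffun s).
Proof.
rewrite -(big_imset _ (in2W perm_ffun_inj)) /=; apply: eq_bigl => f.
apply/idP/imsetP => [/injectiveP f_inj|[s _ ->]]; last exact: injectiveb_perm_ffun.
have bf_inj : injective (b \o f) by move=> i j /= /(can_inj bK)/f_inj.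
by exists (perm bf_inj)^-1%g => //; apply/ffunP=> i; rewrite ffunE invgK permE /= bK.
Qed.

Lemma perm_ffunM s u :
  perm_ffun (s * u)%g = ffun_act (fun g x => to x g) (1%g, (u^-1)%g) (perm_ffun s).
Proof. by apply/ffunP=> i; rewrite !ffunE /= act1 invMg permM. Qed.

(** Left multiplication by the image of the group acts on values, while by [perm_ffunM] right
    multiplication acts on arguments. Equivariance on injective functions thus yields [transfers]
    and [right_invariant]. *)
Lemma perm_ffun_action_hom g s :
  perm_ffun (action_hom to bK b'K g * s)%g =
  ffun_act (fun g x => to x g) ((g^-1)%g, 1%g) (perm_ffun s).
Proof.
apply/ffunP=> i; rewrite !ffunE /= perm1 invMg permM -morphV ?inE //=.
by rewrite actpermE /= /transport_fun bK.
Qed.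

End PermutationFunctions.

Theorem theorem4p1 (k : fieldType) (gT : finGroupType) (n : nat)
  (X Y : finType) (toX : {action gT &-> X}) (toY : {action gT &-> Y})
  (faithX : [faithful [set: gT], on [set: X] | toX])
  (faithY : [faithful [set: gT], on [set: Y] | toY])
  (cardX : #|X| = n) (cardY : #|Y| = n)
  (bX : X -> 'I_n) (bX' : 'I_n -> X)
  (bXK : cancel bX bX') (bX'K : cancel bX' bX)
  (bY : Y -> 'I_n) (bY' : 'I_n -> Y)
  (bYK : cancel bY bY') (bY'K : cancel bY' bY) :
  linearly_equivalent k toX toY ->
  linearly_equivalent k
    (coset_action (action_hom toX bXK bX'K @* [set: gT])%G)
    (coset_action (action_hom toY bYK bY'K @* [set: gT])%G).
Proof.
move/linearly_equivalent_kernel_iso => isoXY.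
have [K [L [eqK eqL KL LK]]] :=
  injective_functions_iso n (fun g => act_inj toX g) (fun g => act_inj toY g) isoXY.
apply: (@linearly_equivalent_cosets _ _ _ _
         (fun s u => K (perm_ffun bX' s) (perm_ffun bY' u))
         (fun u s => L (perm_ffun bY' u) (perm_ffun bX' s))).
(* An element of one image comes from some [g]; its partner is the image of the same [g] under the
   other homomorphism. *)
- move=> _ /morphimP[g _ _ ->]; exists (action_hom toX bXK bX'K g).
    by rewrite mem_morphim ?inE.
  by move=> s u; rewrite !perm_ffun_action_hom eqK.
- move=> _ /morphimP[g _ _ ->]; exists (action_hom toY bYK bY'K g).
    by rewrite mem_morphim ?inE.
  by move=> s u; rewrite !perm_ffun_action_hom eqL.
- by move=> s u v; rewrite (perm_ffunM toX) (perm_ffunM toY) eqK.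
- move=> s u; rewrite -(sum_perm_ffun bYK bY'K (fun f => K (perm_ffun bX' s) f * L f (perm_ffun bX' u))).
  rewrite KL; [|exact: injectiveb_perm_ffun..].
  exact: (congr1 (fun c : bool => c%:R) (inj_eq (perm_ffun_inj bX'K) s u)).
move=> s u; rewrite -(sum_perm_ffun bXK bX'K (fun f => L (perm_ffun bY' s) f * K f (perm_ffun bY' u))).
rewrite LK; [|exact: injectiveb_perm_ffun..].
  exact: (congr1 (fun c : bool => c%:R) (inj_eq (perm_ffun_inj bY'K) s u)).
Qed.
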